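(* Let $\frac12<p<1$ and let $f:\mathbb{Z}^+\to[0,\infty)$ be monotonically increasing (non-decreasing). The non-uniform frog model with drift on $\mathbb{Z}$ with parameters $p$ and $f$ is transient if and only if $$\sum_{j=1}^{\infty}e^{-\frac{1-p}{2p-1}f(j)}=\infty.$$
   Context: The non-uniform frog model with drift on $\mathbb{Z}$: for each positive integer $j$, the number $\eta_j$ of sleeping frogs initially at site $j$ is Poisson with mean $f(j)$, the $\eta_j$ being independent. There are no sleeping frogs at non-positive sites. There is one active frog at the origin at time $0$. Each active frog performs a discrete-time random walk on $\mathbb{Z}$ which at each step moves one unit to the left with probability $p$ and one unit to the right with probability $1-p$, independently of all other frogs. Whenever an active frog lands on a site containing sleeping frogs, those frogs become active and start their own such walks from that site. The model is called transient if the probability that infinitely many distinct frogs hit the origin is $0$, and non-transient if this probability is positive. *)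

(* Defs.v *)
From HB Require Import structures.
From mathcomp Require Import all_boot all_order all_algebra.
From mathcomp Require Import all_classical all_reals all_analysis.
Set Implicit Arguments. Unset Strict Implicit. Unset Printing Implicit Defensive.
Import Order.TTheory GRing.Theory Num.Theory.
Local Open Scope classical_set_scope.
Local Open Scope ring_scope.

(* Frogs: [None] is the initially active frog at the origin; [Some (j, k)]
   is the k-th sleeping frog at site j (it exists iff 1 <= j and k < eta_j).
   Each frog label carries its own walk; walks of non-existing frogs are unused. *)
Definition frog := option (nat * nat).

Definition frog_start (fr : frog) : int :=
  if fr is Some (j, _) then Posz j else 0.

Definition frog_pos (step : frog -> nat -> bool) (fr : frog) (n : nat) : int :=
  frog_start fr + \sum_(i < n) (if step fr i then (-1)%R else 1%R).

(* Sites ever landed on by an active frog (timing is irrelevant to the set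
   of woken frogs): the sites visited by the origin frog, and the sites visited
   by frogs sleeping at an already visited site. *)
Inductive visited_site (eta : nat -> nat) (step : frog -> nat -> bool) : int -> Prop :=
| vs_init n : visited_site eta step (frog_pos step None n)
| vs_woken j k n : (0 < j)%N -> (k < eta j)%N -> visited_site eta step (Posz j) ->
    visited_site eta step (frog_pos step (Some (j, k)) n).

Definition woken (eta : nat -> nat) (step : frog -> nat -> bool) (jk : nat * nat) : Prop :=
  [/\ (0 < jk.1)%N, (jk.2 < eta jk.1)%N & visited_site eta step (Posz jk.1)].

Definition hits_origin (step : frog -> nat -> bool) (fr : frog) : Prop :=
  exists n, frog_pos step fr n = 0.

Definition inf_many_hit {T : Type} (eta : nat -> T -> nat)
    (xi : frog -> nat -> T -> bool) : set T :=
  [set w | ~ finite_set [set jk : nat * nat |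
      woken (eta ^~ w) (fun fr n => xi fr n w) jk /\
      hits_origin (fun fr n => xi fr n w) (Some jk)]].

Definition mutually_independent {R : realType} {d} {T : measurableType d}
    (P : probability T R) {I : eqType} (X : I -> T -> nat) : Prop :=
  forall (s : seq I) (x : I -> nat), uniq s ->
    P (\bigcap_(i in [set` s]) (X i @^-1` [set x i])) =
    (\prod_(i <- s) P (X i @^-1` [set x i]))%E.

Definition frog_family {T : Type} (eta : nat -> T -> nat)
    (xi : frog -> nat -> T -> bool) (i : nat + (frog * nat)) : T -> nat :=
  match i with
  | inl j => eta j
  | inr (fr, n) => fun w => nat_of_bool (xi fr n w)
  end.

Definition frog_model {R : realType} {d} {T : measurableType d}
    (P : probability T R) (p : R) (f : nat -> R)
    (eta : nat -> T -> nat) (xi : frog -> nat -> T -> bool) : Prop :=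
  [/\ (forall j k, measurable (eta j @^-1` [set k])),
      (forall fr n b, measurable (xi fr n @^-1` [set b])),
      (forall j k, (0 < j)%N ->
          P (eta j @^-1` [set k]) = (f j ^+ k / k`!%:R * expR (- f j))%:E),
      (forall fr n, P (xi fr n @^-1` [set true]) = p%:E)
    & mutually_independent P (frog_family eta xi)].

Definition transient {R : realType} {d} {T : measurableType d}
    (P : probability T R) (eta : nat -> T -> nat)
    (xi : frog -> nat -> T -> bool) : Prop :=
  P.-negligible (inf_many_hit eta xi).

(* Main.v *)
Require Import Defs.
From HB Require Import structures.
From mathcomp Require Import all_boot all_order all_algebra.
From mathcomp Require Import all_classical all_reals all_analysis.
From mathcomp Require Import zify ring lra.
Set Implicit Arguments. Unset Strict Implicit. Unset Printing Implicit Defensive.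
Import Order.TTheory GRing.Theory Num.Theory.
Import numFieldNormedType.Exports.
Local Open Scope classical_set_scope.
Local Open Scope ring_scope.

(* Write [rho = (1 - p) / p] for the probability that a walk ever rises by one, and say that
   level [n] is blocked if no frog from the sites [0, ..., n] ever reaches [n + 1]. All sites
   are visited iff no level is blocked, and almost surely every woken frog hits the origin, so
   the model is transient iff almost surely some level is blocked. By Poisson thinning, no frog
   from the sites [n + 1, ..., n + k] reaches [n + k + 1] with probability
   [expR (- pressure n k)], [pressure n k] being the sum of [f (n + i + 1) * rho ^ (k - i)] over
   [i < k].

   If the series converges, so does that of [u_k := expR (- pressure 0 k)], by convexity of the
   exponential. Letting the initial frog walk straight to a far site [N] (an independent event
   of positive probability), a union bound over the levels past [N] leaves a positive
   probability that none is blocked.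

   If the series diverges, then so does that of [u_k], because [pressure 0 k <= c * f k] with
   [c = rho / (1 - rho)]. Decomposing according to the first blocked level [n] gives
   [(1 - rho ^ (m + 1)) * u_m = sum_(n <= m) F_n * expR (- pressure n (m - n))], which is at
   most [sum_(n <= m) F_n * u_(m - n)] since [f] is nondecreasing. Summing over [m < N] and
   letting [N] go to infinity forces [sum F_n = 1]. *)

(** * Sigma-algebras generated by subfamilies of discrete variables *)

Section Generated.
Context {T : Type} {I : eqType}.
Variable X : I -> T -> nat.

(** Cylinders that prescribe different values at a common index are disjoint; [set0] is included so
    that the cylinders form a pi-system. *)
Definition cylinder (J : set I) : set (set T) :=
  [set A | A = set0 \/ exists s x, [/\ uniq s, [set` s] `<=` J &
     A = \bigcap_(i in [set` s]) (X i @^-1` [set x i])]].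

Definition generated (J : set I) : set (set T) := <<s cylinder J >>.

Lemma cylinder_setI_closed J : setI_closed (cylinder J).
Proof.
move=> A B [->|[s [x [us sJ ->]]]]; first by left; rewrite set0I.
case=> [->|[s' [x' [us' sJ' ->]]]]; first by left; rewrite setI0.
have [agree|] := pselect (forall i, i \in s -> i \in s' -> x i = x' i).
- right; exists (undup (s ++ s')), (fun i => if i \in s then x i else x' i).
  split; first exact: undup_uniq.
  + by move=> i /=; rewrite mem_undup mem_cat => /orP[/sJ|/sJ'].
  + apply/seteqP; split=> w.
      move=> [h h'] i /=; rewrite mem_undup mem_cat => /orP[si|si'].
        by rewrite si; apply: h.
      by case: ifPn => [si|_]; [exact: h|exact: h'].
    move=> h; split=> i /= si.
      by have := h i; rewrite /= mem_undup mem_cat si => /(_ isT).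
    have := h i; rewrite /= mem_undup mem_cat si orbT => /(_ isT).
    by case: ifPn => // si1 ->; apply: agree.
- move=> /existsNP[i /not_implyP[si /not_implyP[si' ne]]]; left.
  apply/seteqP; split=> // w [/(_ i si) /= h /(_ i si') /= h'].
  by apply: ne; rewrite -h h'.
Qed.

Lemma generated_preimage (J : set I) i x : J i -> generated J (X i @^-1` [set x]).
Proof.
move=> Ji; apply: sub_sigma_algebra; right; exists [:: i], (fun=> x).
split=> //; first by move=> j /=; rewrite inE => /eqP ->.
apply/seteqP; split=> w /=; first by move=> h j /=; rewrite inE => /eqP ->.
by move=> /(_ i); apply; rewrite /= inE.
Qed.

Lemma sub_generated (J K : set I) : J `<=` K -> generated J `<=` generated K.
Proof.
move=> JK; apply: sub_sigma_algebra2 => A [->|[s [x [us sJ ->]]]]; first by left.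
by right; exists s, x; split=> //; exact: subset_trans JK.
Qed.

Lemma generated0 J : generated J set0.
Proof. exact: sigma_algebra0. Qed.

Lemma generatedC J A : generated J A -> generated J (~` A).
Proof. by move=> h; rewrite -setTD; exact: sigma_algebraCD. Qed.

Lemma generatedT J : generated J setT.
Proof. by rewrite -setC0; apply: generatedC; exact: generated0. Qed.

Lemma generated_bigcup J (F : nat -> set T) :
  (forall n, generated J (F n)) -> generated J (\bigcup_n F n).
Proof. exact: sigma_algebra_bigcup. Qed.

Lemma generated_bigcap J (F : nat -> set T) :
  (forall n, generated J (F n)) -> generated J (\bigcap_n F n).
Proof.
move=> h; rewrite -[X in generated J X]setCK setC_bigcap; apply: generatedC.
by apply: generated_bigcup => n; exact: generatedC.
Qed.

Lemma generatedI J A B : generated J A -> generated J B -> generated J (A `&` B).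
Proof.
move=> hA hB; rewrite -bigcap2E; apply: generated_bigcap => -[|[|n]] //=.
exact: generatedT.
Qed.

Lemma generatedU J A B : generated J A -> generated J B -> generated J (A `|` B).
Proof.
by move=> hA hB; rewrite -bigcup2E; apply: generated_bigcup => -[|[|n]] //=; exact: generated0.
Qed.

Lemma generatedD J A B : generated J A -> generated J B -> generated J (A `\` B).
Proof. by move=> hA hB; rewrite setDE; apply: generatedI => //; exact: generatedC. Qed.

End Generated.

(** * Independence over disjoint index sets, by Dynkin's theorem *)

Section Independence.
Context {R : realType} {d : measure_display} {T : measurableType d}.
Context {I : eqType}.
Variables (P : probability T R) (X : I -> T -> nat).
Hypothesis mX : forall i x, measurable (X i @^-1` [set x]).
Hypothesis indX : mutually_independent P X.

Lemma cylinder_measurable J : cylinder X J `<=` measurable.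
Proof.
move=> A [->//|[s [x [us _ ->]]]].
by apply: fin_bigcap_measurable.
Qed.

Lemma generated_measurable J : generated X J `<=` measurable.
Proof.
apply: smallest_sub; first exact: sigma_algebra_measurable.
exact: cylinder_measurable.
Qed.

(** Disjointness of [J] and [K] makes the concatenated index list duplicate-free, so mutual
    independence applies to it as a whole. *)
Lemma cylinder_independent (J K : set I) A B : J `&` K = set0 ->
  cylinder X J A -> cylinder X K B -> P (A `&` B) = (P A * P B)%E.
Proof.
move=> JK [->|[s [x [us sJ ->]]]]; first by rewrite set0I measure0 mul0e.
case=> [->|[s' [x' [us' sK' ->]]]]; first by rewrite setI0 measure0 mule0.
have dis i : i \in s' -> i \in s = false.
  move=> si'; apply/negP => si; have : set0 i by rewrite -JK; split; [exact: sJ|exact: sK'].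
  by [].
have uss : uniq (s ++ s').
  by rewrite cat_uniq us us' andbT /=; apply/hasPn => i /dis ->.
have := indX (fun i => if i \in s then x i else x' i) uss.
rewrite big_cat /= (indX x us) (indX x' us').
rewrite (eq_big_seq (fun i => P (X i @^-1` [set x i]))); last by move=> i ->.
rewrite [X in (_ * X)%E](eq_big_seq (fun i => P (X i @^-1` [set x' i]))); last first.
  by move=> i si /=; rewrite dis.
move=> <-; congr (P _); apply/seteqP; split=> w.
  move=> [h h'] i /=; rewrite mem_cat => /orP[si|si'].
    by rewrite si; apply: h.
  by rewrite dis //; apply: h'.
move=> h; split=> i /= si.
  by have := h i; rewrite /= mem_cat si => /(_ isT).
by have := h i; rewrite /= mem_cat si orbT dis // => /(_ isT).
Qed.

(** The measurable events that satisfy the product formula with [B] form a Dynkin system, so the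
    pi-lambda theorem applies. *)
Lemma dynkin_independent (G : set (set T)) B : G `<=` measurable ->
  setI_closed G -> measurable B ->
  (forall A, G A -> P (A `&` B) = (P A * P B)%E) ->
  forall A, <<s G >> A -> P (A `&` B) = (P A * P B)%E.
Proof.
move=> mG IG mB GB.
pose D := [set A | measurable A /\ P (A `&` B) = (P A * P B)%E].
have DD : dynkin D.
  split.
  - by split=> //; rewrite setTI probability_setT mul1e.
  - move=> A [mA hA]; split; first exact: measurableC.
    rewrite setIC -setDE measureD //=; last first.
      by rewrite (le_lt_trans (probability_le1 P mB)) ?ltry.
    rewrite setIC hA probability_setC // muleBl ?mul1e ?fin_num_measure //.
  - move=> F tF hF; have mF i : measurable (F i) by case: (hF i).
    split; first exact: bigcupT_measurable.
    rewrite setI_bigcupl measure_bigcup //; first last.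
    + by apply: trivIset_setIr.
    + by move=> i _; exact: measurableI.
    rewrite (eq_eseriesr (g := fun i => (P B * P (F i))%E)); last first.
      by move=> i _ /=; case: (hF i) => _; rewrite muleC => <-.
    by rewrite -(fineK (fin_num_measure P _ mB)) nneseriesZl // muleC measure_bigcup.
have GD : G `<=` D by move=> A GA; split; [exact: mG|exact: GB].
move=> A; rewrite -setI_closed_g_dynkin_g_sigma_algebra // => /(_ D) h.
by have [] := h (conj DD GD).
Qed.

(** Dynkin's theorem is used twice: once to pass from cylinders over [J] to the sigma-algebra with
    [B] fixed, and once over [K] with a cylinder over [J] fixed. *)
Lemma generated_independent (J K : set I) A B : J `&` K = set0 ->
  generated X J A -> generated X K B -> P (A `&` B) = (P A * P B)%E.
Proof.
move=> JK hA hB.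
apply: (dynkin_independent (@cylinder_measurable J)) => //.
- exact: cylinder_setI_closed.
- exact: generated_measurable hB.
- move=> {hA} A hA; rewrite setIC muleC.
  apply: (dynkin_independent (@cylinder_measurable K)) => //.
  + exact: cylinder_setI_closed.
  + exact: cylinder_measurable hA.
  + by move=> {hB} B hB; rewrite setIC muleC; exact: cylinder_independent JK _ _.
Qed.

End Independence.

(** * Gambler's ruin for a biased walk *)

Section GamblersRuin.
Context {R : realType}.
Variable a : R.
Hypotheses (a0 : 0 < a) (a1 : a < 1).

Let b0 : 0 < 1 - a. Proof. by rewrite subr_gt0. Qed.
Let b_neq0 : 1 - a != 0. Proof. exact: lt0r_neq0. Qed.

Let average_le (x y x' y' : R) : x <= x' -> y <= y' ->
  a * x + (1 - a) * y <= a * x' + (1 - a) * y'.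
Proof. by move=> hx hy; apply: lerD; apply: ler_wpM2l => //; exact: ltW. Qed.

Let ratio_ge0 : 0 <= a / (1 - a).
Proof. by rewrite divr_ge0 // ltW. Qed.

(** The probability of climbing by [i] within [t] steps, each going up with probability [a]: after
    the first step the target is one nearer or one farther. *)
Fixpoint hit_prob (t i : nat) : R :=
  match i with
  | 0%N => 1
  | i'.+1 => match t with
             | 0%N => 0
             | t'.+1 => a * hit_prob t' i' + (1 - a) * hit_prob t' i'.+2
             end
  end.

Lemma hit_prob0 t : hit_prob t 0 = 1. Proof. by case: t. Qed.

Lemma hit_probSS t i :
  hit_prob t.+1 i.+1 = a * hit_prob t i + (1 - a) * hit_prob t i.+2.
Proof. by []. Qed.

Lemma hit_prob_ge0 t i : 0 <= hit_prob t i.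
Proof.
elim: t i => [[|i]|t IH [|i]] //=; rewrite ?ler01 //.
by apply: le_trans (average_le (IH i) (IH i.+2)); lra.
Qed.

Lemma hit_prob_le1 t i : hit_prob t i <= 1.
Proof.
elim: t i => [[|i]|t IH [|i]] //=.
by apply: le_trans (average_le (IH i) (IH i.+2)) _; lra.
Qed.

Lemma hit_prob_nondecreasing i : nondecreasing_seq (hit_prob ^~ i).
Proof.
apply/nondecreasing_seqP => t; elim: t i => [[|i]|t IH [|i]] //.
- exact: hit_prob_ge0.
- by rewrite !hit_probSS; exact: average_le.
Qed.

Lemma hit_prob_is_cvg i : cvgn (hit_prob ^~ i).
Proof.
apply: nondecreasing_is_cvgn; first exact: hit_prob_nondecreasing.
by exists 1 => _ [t _ <-]; exact: hit_prob_le1.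
Qed.

Definition ruin_prob i : R := limn (hit_prob ^~ i).

Lemma hit_prob_cvg i : hit_prob t i @[t --> \oo] --> ruin_prob i.
Proof. exact: hit_prob_is_cvg. Qed.

Lemma ruin_prob0 : ruin_prob 0 = 1.
Proof.
apply/cvg_lim => //; under eq_fun do rewrite hit_prob0.
exact: cvg_cst.
Qed.

Lemma ruin_prob_ge0 i : 0 <= ruin_prob i.
Proof. by apply: limr_ge; [exact: hit_prob_is_cvg|near=> t; exact: hit_prob_ge0].
Unshelve. all: by end_near. Qed.

Lemma ruin_prob_le1 i : ruin_prob i <= 1.
Proof. by apply: limr_le; [exact: hit_prob_is_cvg|near=> t; exact: hit_prob_le1].
Unshelve. all: by end_near. Qed.

Lemma ruin_probS i : ruin_prob i.+1 = a * ruin_prob i + (1 - a) * ruin_prob i.+2.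
Proof.
have h : hit_prob t.+1 i.+1 @[t --> \oo] --> ruin_prob i.+1.
  by rewrite (cvg_shiftS (hit_prob ^~ i.+1)); exact: hit_prob_cvg.
rewrite -(cvg_lim _ h) //; apply/cvg_lim => //.
under eq_fun do rewrite hit_probSS.
by apply: cvgD; apply: cvgMr; exact: hit_prob_cvg.
Qed.

(** The recursion says that consecutive increments of [e] have ratio [a / (1 - a)]. *)
Lemma harmonic_geometric (e : nat -> R) : e 0%N = 0 ->
  (forall i, e i.+1 = a * e i + (1 - a) * e i.+2) ->
  forall i, e i = e 1%N * \sum_(k < i) (a / (1 - a)) ^+ k.
Proof.
move=> e0 eS.
have inc i : e i.+1 - e i = e 1%N * (a / (1 - a)) ^+ i.
  elim: i => [|i IH]; first by rewrite e0 expr0; lra.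
  rewrite exprS mulrCA -IH; have := eS i.
  by move=> h; apply: (mulfI b_neq0); rewrite mulrA mulrCA divff // mulr1; lra.
elim=> [|i IH]; first by rewrite big_ord0 mulr0.
by rewrite big_ord_recr /= mulrDr -IH -inc addrC subrK.
Qed.

(** The defect [e] from 1 is harmonic and vanishes at 0. Its increments have ratio at least 1, so it
    would grow at least linearly if [e 1] were positive, yet it is bounded by 1. *)
Lemma ruin_prob_recurrent : 1 / 2 < a -> forall i, ruin_prob i = 1.
Proof.
move=> a2 i; pose e i := 1 - ruin_prob i.
have e0 : e 0%N = 0 by rewrite /e ruin_prob0 subrr.
have eS k : e k.+1 = a * e k + (1 - a) * e k.+2 by rewrite /e ruin_probS; ring.
have eg := harmonic_geometric e0 eS.
have e1 : e 1%N = 0.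
  apply/eqP; rewrite eq_le; apply/andP; split; last by rewrite subr_ge0 ruin_prob_le1.
  rewrite leNgt; apply/negP => e1.
  have bnd n : n%:R * e 1%N <= 1.
    apply: (@le_trans _ _ (e n)); last by rewrite /e; have := ruin_prob_ge0 n; lra.
    rewrite (eg n) mulrC ler_pM2l // -[X in X%:R]card_ord -sumr_const; apply: ler_sum => k _.
    by apply: exprn_ege1; rewrite ler_pdivlMr //; lra.
  have := bnd (Num.truncn (e 1%N)^-1).+1; rewrite leNgt => /negP; apply.
  by rewrite -ltr_pdivrMr // mul1r truncnS_gt.
by apply/eqP; rewrite eq_sym -subr_eq0 -/(e i) (eg i) e1 mul0r.
Qed.

(** The geometric sequence is itself harmonic and dominates at time 0; averaging preserves the
    domination. *)
Lemma hit_prob_le_geometric t i : hit_prob t i <= (a / (1 - a)) ^+ i.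
Proof.
elim: t i => [|t IH] [|i] //; first by rewrite exprn_ge0.
rewrite hit_probSS.
have -> : (a / (1 - a)) ^+ i.+1 =
  a * (a / (1 - a)) ^+ i + (1 - a) * (a / (1 - a)) ^+ i.+2.
  by rewrite !exprS; field.
exact: average_le.
Qed.

(** The defect [e] from the geometric bound is nonnegative and harmonic, hence at least [e 1] from
    index 1 on; being at most [r ^+ i], which tends to 0, it vanishes. *)
Lemma ruin_prob_transient : a < 1 / 2 -> forall i, ruin_prob i = (a / (1 - a)) ^+ i.
Proof.
move=> a2 i; set r := a / (1 - a).
have r0 : 0 <= r := ratio_ge0.
have r1 : r < 1 by rewrite ltr_pdivrMr //; lra.
pose e i := r ^+ i - ruin_prob i.
have e0 : e 0%N = 0 by rewrite /e ruin_prob0 subrr.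
have eS k : e k.+1 = a * e k + (1 - a) * e k.+2.
  rewrite /e ruin_probS !exprS.
  have hr : r * r ^+ k = a * r ^+ k + (1 - a) * (r * (r * r ^+ k)).
    by rewrite /r; field.
  by rewrite {1}hr; ring.
have e_ge0 k : 0 <= e k.
  rewrite subr_ge0; apply: limr_le; first exact: hit_prob_is_cvg.
  by near=> t; exact: hit_prob_le_geometric.
have eg := harmonic_geometric e0 eS.
have e1 : e 1%N = 0.
  apply/eqP; rewrite eq_le e_ge0 andbT.
  have rcv : (fun n => r ^+ n.+1) @ \oo --> (0 : R).
    by rewrite (cvg_shiftS (GRing.exp r)); apply: cvg_expr; rewrite ger0_norm.
  rewrite -(cvg_lim _ rcv) //; apply: limr_ge; first by apply/cvg_ex; exists 0.
  near=> n; apply: (@le_trans _ _ (e n.+1)).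
    rewrite (eg n.+1) big_ord_recl expr0 -[leLHS]mulr1 ler_wpM2l // lerDl.
    by apply: sumr_ge0 => k _; rewrite exprn_ge0.
  by rewrite /e gerBl ruin_prob_ge0.
by apply/eqP; rewrite eq_sym -subr_eq0 -/(e i) (eg i) e1 mul0r.
Unshelve. all: by end_near. Qed.

End GamblersRuin.

(** * Deterministic paths: climbing, falling and hitting levels *)

(* [reaches b x t i]: within [t] steps, the walk that goes up on steps equal to [b]
   and down on the others gets to height [i]. *)
Fixpoint reaches (b : bool) (x : nat -> bool) (t i : nat) : bool :=
  match i with
  | 0%N => true
  | i'.+1 => match t with
             | 0%N => false
             | t'.+1 => if x 0%N == b then reaches b (x \o S) t' i'
                        else reaches b (x \o S) t' i'.+2
             end
  end.

Lemma reachesP b x t i : reaches b x t i <->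
  exists2 u, (u <= t)%N & (i%:Z <= \sum_(v < u) (if x v == b then 1 else -1)).
Proof.
have sumS (y : nat -> bool) u : \sum_(v < u.+1) (if y v == b then 1 else -1 : int) =
    (if y 0%N == b then 1 else -1) + \sum_(v < u) (if (y \o S) v == b then 1 else -1).
  by rewrite big_ord_recl.
elim: t x i => [|t IH] x [|i].
- by split=> // _; exists 0%N; rewrite // big_ord0.
- by split=> // -[[|u]] // _; rewrite big_ord0.
- by split=> // _; exists 0%N; rewrite // big_ord0.
- rewrite [reaches _ _ _ _]/=; split.
    case: ifPn => xb /IH[u ut hu]; exists u.+1 => //; rewrite sumS ?xb ?(negbTE xb);
      move: (\sum_(v < u) _) hu => S; lia.
  case=> -[|u] ut; first by rewrite big_ord0.
  by rewrite sumS; case: ifPn => xb hu; apply/IH; exists u => //;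
    move: (\sum_(v < u) _) hu => S; lia.
Qed.

Lemma reaches_nondecreasing b x i t t' :
  (t <= t')%N -> reaches b x t i -> reaches b x t' i.
Proof.
by move=> tt' /reachesP[u ut hu]; apply/reachesP; exists u => //; exact: leq_trans tt'.
Qed.

(** A step [true] moves left, so rising is climbing along the steps equal to [false]. *)
Definition rises (step : frog -> nat -> bool) (fr : frog) (i : nat) : Prop :=
  exists t, reaches false (step fr) t i.

Definition falls (step : frog -> nat -> bool) (fr : frog) (i : nat) : Prop :=
  exists t, reaches true (step fr) t i.

Lemma risesP step fr i :
  rises step fr i <-> exists t, frog_start fr + i%:Z <= frog_pos step fr t.
Proof.
split=> [[t /reachesP[u _ hu]]|[t ht]].
  exists u; rewrite /frog_pos lerD2l (le_trans hu) //.
  by apply: ler_sum => v _; case: (step fr v).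
exists t; apply/reachesP; exists t => //.
move: ht; rewrite /frog_pos lerD2l => /le_trans; apply.
by apply: ler_sum => v _; case: (step fr v).
Qed.

Lemma rises_le step fr i i' : (i <= i')%N -> rises step fr i' -> rises step fr i.
Proof. by move=> ii' /risesP[t ht]; apply/risesP; exists t; lia. Qed.

(** A discrete intermediate value theorem: upward moves by at most one cannot skip [L]. *)
Lemma walk_hits_level (g : nat -> int) (L : int) t :
  (forall n, g n.+1 <= g n + 1) -> g 0%N <= L <= g t -> exists u, g u = L.
Proof.
move=> gS; elim: t => [|t IH] h; first by exists 0%N; lia.
have [gL|gL] := leP L (g t); first by apply: IH; lia.
by exists t.+1; have := gS t; lia.
Qed.

Lemma frog_pos0 step fr : frog_pos step fr 0 = frog_start fr.
Proof. by rewrite /frog_pos big_ord0 addr0. Qed.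

Lemma frog_posS step fr n :
  frog_pos step fr n.+1 = frog_pos step fr n + (if step fr n then -1 else 1).
Proof. by rewrite /frog_pos big_ord_recr /= addrA. Qed.

Lemma rises_visits step fr i :
  rises step fr i -> exists t, frog_pos step fr t = frog_start fr + i%:Z.
Proof.
move=> /risesP[t ht]; apply: (@walk_hits_level _ _ t).
  by move=> n; rewrite frog_posS; case: (step fr n); lia.
by rewrite frog_pos0; lia.
Qed.

Lemma falls_hits_origin step j k : falls step (Some (j, k)) j -> hits_origin step (Some (j, k)).
Proof.
move=> [t /reachesP[u _ hu]].
(* The reflected path starts at [- j] and climbs to 0. *)
have [] := @walk_hits_level (fun n => - frog_pos step (Some (j, k)) n) 0 u.
- by move=> n; rewrite frog_posS; case: (step _ n); lia.
- rewrite frog_pos0 /= /frog_pos /=.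
  have -> : \sum_(i < u) (if step (Some (j, k)) i then -1 else 1 : int) =
    - \sum_(v < u) (if step (Some (j, k)) v == true then 1 else -1).
    by rewrite -sumrN; apply: eq_bigr => v _; case: (step _ v).
  by move: (\sum_(v < u) _) hu => S; lia.
- by move=> v hv; exists v; lia.
Qed.

(** * Blocked levels and the set of woken frogs, for fixed paths *)

Section Blocking.
Variables (eta : nat -> nat) (step : frog -> nat -> bool).

(** Frogs at the sites up to [n] count whether woken or not. This keeps the waking dynamics out of
    the event and makes it an intersection over independent frogs and sites. *)
Definition blocked (n : nat) : Prop :=
  ~ rises step None n.+1 /\
  forall j k, (0 < j <= n)%N -> (k < eta j)%N -> ~ rises step (Some (j, k)) (n.+1 - j).

Lemma blocked_visited n z : blocked n -> visited_site eta step z -> z <= n%:Z.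
Proof.
move=> [bN bS]; elim=> [m|j k m j0 kj _ jn]; rewrite leNgt; apply/negP => h.
  by apply: bN; apply/risesP; exists m; rewrite /= add0r; lia.
by apply: (bS j k) => //; [lia|]; apply/risesP; exists m; rewrite /=; lia.
Qed.

Lemma blocked_finite n : blocked n -> finite_set (woken eta step).
Proof.
(* The sum bounds each single [eta j], so one rectangle holds all woken frogs. *)
move=> bn; apply: (@sub_finite_set _ _ (`I_n.+1 `*` `I_(\sum_(j < n.+1) eta j))).
  move=> [j k] [/= j0 kj /(blocked_visited bn)]; rewrite lez_nat => jn.
  split=> //=; apply: leq_trans kj _.
  by rewrite (bigD1 (Ordinal (jn : (j < n.+1)%N))) //= leq_addr.
exact: finite_setX.
Qed.

Hypothesis bounded : forall jk, exists i, ~ rises step (Some jk) i.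
Hypothesis returns : forall jk, hits_origin step (Some jk).
Variable N : nat.
Hypothesis head_start : forall n, (n < N)%N -> step None n = false.
Hypothesis unblocked : forall n, (N <= n)%N -> exists j k,
  [/\ (0 < j <= n)%N, (k < eta j)%N & rises step (Some (j, k)) (n.+1 - j)].

(** Up to [N] the initial frog visits every site on its straight run. Beyond, the next site is
    reached by a frog whose own site is visited by induction, so that this frog is awake. *)
Lemma unblocked_visited n : visited_site eta step n%:Z.
Proof.
elim/ltn_ind: n => n IH; have [nN|Nn] := leqP n N.
  have -> : n%:Z = frog_pos step None n; last exact: vs_init.
  rewrite /frog_pos /= add0r (eq_bigr (fun=> 1)); last first.
    by move=> i _; rewrite head_start // (leq_trans (ltn_ord i)).
  by rewrite sumr_const card_ord natz.
case: n IH Nn => // n IH Nn.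
have [j [k [jn kj /rises_visits[t]]]] := unblocked Nn.
rewrite /= => ht; have -> : n.+1%:Z = frog_pos step (Some (j, k)) t by lia.
by apply: vs_woken => //; [lia|apply: IH; lia].
Qed.

(** If only the frogs of a list [s] were woken, each rising by less than its [bound], none could
    cross a level [n] above all the sums of site and bound; but some woken frog crosses it. *)
Lemma unblocked_infinite :
  ~ finite_set [set jk : nat * nat | woken eta step jk /\ hits_origin step (Some jk)].
Proof.
move=> /finite_seqP[s hs].
pose bound jk := sval (cid (bounded jk)).
pose n := (N + \sum_(jk <- s) (jk.1 + bound jk))%N.
have [j [k [jn kj hr]]] := unblocked (leq_addr _ _ : (N <= n)%N).
have js : (j, k) \in s.
  have : [set` s] (j, k) by rewrite -hs; split=> //; split=> //=; [lia|exact: unblocked_visited].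
  by [].
have := svalP (cid (bounded (j, k))); apply; apply: rises_le hr.
have : (j + bound (j, k) <= \sum_(jk <- s) (jk.1 + bound jk))%N.
  by rewrite (big_rem _ js) /= leq_addr.
by rewrite /n /bound; lia.
Qed.

End Blocking.

(** * Inequalities for the pressure, and the renewal argument *)

Section Pressure.
Context {R : realType}.
Implicit Types (r : R) (f : nat -> R).

(* The expected number of frogs from the sites [n + 1, ..., n + k] that reach [n + k + 1],
   when [r] is the probability of ever rising by one. *)
Definition pressure r f n k : R := \sum_(i < k) f (n + i).+1 * r ^+ (k - i).

Lemma pressure0 r f n : pressure r f n 0 = 0.
Proof. by rewrite /pressure big_ord0. Qed.

Lemma pressureS r f n k : pressure r f n k.+1 = r * (pressure r f n k + f (n + k).+1).
Proof.
rewrite /pressure big_ord_recr /= subSnn expr1 mulrDr [r * f _]mulrC; congr (_ + _).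
rewrite mulr_sumr; apply: eq_bigr => i _.
by rewrite (subSn (ltnW (ltn_ord i))) exprS mulrCA.
Qed.

Lemma pressure_shift r f n k : 0 <= r ->
  (forall i j, (0 < i)%N -> (i <= j)%N -> f i <= f j) ->
  pressure r f 0 k <= pressure r f n k.
Proof.
move=> r0 fmono; apply: ler_sum => i _; apply: ler_wpM2r; first exact: exprn_ge0.
by apply: fmono => //; rewrite ltnS leq_add2r.
Qed.

(** The constant [c = r / (1 - r)] solves [r * (c + 1) = c], so the recursion for [pressure]
    reproduces the bound. *)
Lemma pressure_le r f k : 0 <= r -> r < 1 ->
  (forall j, (0 < j)%N -> 0 <= f j) ->
  (forall i j, (0 < i)%N -> (i <= j)%N -> f i <= f j) ->
  pressure r f 0 k.+1 <= r / (1 - r) * f k.+1.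
Proof.
move=> r0 r1 f0 fmono.
have r1' : 1 - r != 0 by rewrite subr_eq0; apply/negP => /eqP; lra.
have cE x : r * (r / (1 - r) * x + x) = r / (1 - r) * x by field.
have c0 : 0 <= r / (1 - r) by apply: divr_ge0; lra.
elim: k => [|k IH].
  rewrite pressureS pressure0 -[leRHS]cE; apply: ler_wpM2l => //.
  by rewrite lerD2r; apply: mulr_ge0 => //; exact: f0.
rewrite pressureS -[leRHS]cE; apply: ler_wpM2l => //.
rewrite lerD2r; apply: le_trans IH _; apply: ler_wpM2l => //.
by apply: fmono.
Qed.

(** Both exponentials lie above the tangent at the average [z], and the linear terms cancel on
    averaging. *)
Lemma expR_convex2 (r x y : R) : 0 <= r -> r <= 1 ->
  expR (r * x + (1 - r) * y) <= r * expR x + (1 - r) * expR y.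
Proof.
move=> r0 r1; set z := r * x + _.
have tangent v : expR z * (1 + (v - z)) <= expR v.
  have -> : expR v = expR z * expR (v - z) by rewrite -expRD addrC subrK.
  by rewrite ler_pM2l ?expR_gt0 // expR_ge1Dx.
have zE e : e = r * (e * (1 + (x - z))) + (1 - r) * (e * (1 + (y - z))).
  by rewrite /z; ring.
rewrite [leLHS](zE (expR z)).
by apply: lerD; apply: ler_wpM2l => //; rewrite subr_ge0.
Qed.

(* Jensen, unrolled: [pressure_(k+1)] is the average of [pressure_k] and [c f(k+1)] with
   weights [r] and [1 - r], where [c = r / (1 - r)]. *)
Lemma sum_expR_pressure r f N : 0 <= r -> r < 1 ->
  (1 - r) * \sum_(k < N.+1) expR (- pressure r f 0 k) <=
  1 + (1 - r) * \sum_(k < N) expR (- (r / (1 - r) * f k.+1)).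
Proof.
move=> r0 r1.
have r1' : 1 - r != 0 by rewrite subr_eq0; apply/negP => /eqP; lra.
have step k : expR (- pressure r f 0 k.+1) <=
    r * expR (- pressure r f 0 k) + (1 - r) * expR (- (r / (1 - r) * f k.+1)).
  apply: le_trans (expR_convex2 _ _ r0 (ltW r1)).
  by rewrite ler_expR pressureS add0n le_eqVlt; apply/orP; left; apply/eqP; field.
pose e k := expR (- pressure r f 0 k).
have sum_l : \sum_(k < N.+1) e k = 1 + \sum_(k < N) e k.+1.
  by rewrite big_ord_recl /= /e pressure0 oppr0 expR0.
have sum_r : \sum_(k < N.+1) e k = \sum_(k < N) e k + e N by rewrite big_ord_recr.
have eN : 0 <= r * e N by rewrite mulr_ge0 // expR_ge0.
have : \sum_(k < N) e k.+1 <= r * \sum_(k < N) e k +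
    (1 - r) * \sum_(k < N) expR (- (r / (1 - r) * f k.+1)).
  by rewrite !mulr_sumr -big_split; apply: ler_sum => k _; exact: step.
rewrite -/(\sum_(k < N.+1) e k) sum_l.
have /(congr1 ( *%R r)) := etrans (esym sum_l) sum_r.
move: (\sum_(k < N) e k) (\sum_(k < N) e k.+1) => a b.
by move: (\sum_(k < N) _) => c; lra.
Qed.

Lemma sum_geometric_le r N : 0 <= r -> r < 1 -> (1 - r) * \sum_(m < N) r ^+ m.+1 <= 1.
Proof.
move=> r0 r1; apply: (@le_trans _ _ (r * (1 - r ^+ N))).
  rewrite le_eqVlt; apply/orP; left; apply/eqP.
  elim: N => [|N IH]; first by rewrite big_ord0 expr0; ring.
  by rewrite big_ord_recr /= mulrDr IH !exprS; ring.
have : 0 <= r ^+ N by exact: exprn_ge0.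
nra.
Qed.

Lemma convolution_sum (F u : nat -> R) N :
  \sum_(m < N) \sum_(n < m.+1) F n * u (m - n)%N =
  \sum_(n < N) F n * \sum_(k < N - n) u k.
Proof.
elim: N => [|N IH]; first by rewrite !big_ord0.
rewrite big_ord_recr /= IH.
(* The added term [n = N] carries an empty inner sum and aligns the two ranges. *)
have -> : \sum_(n < N) F n * \sum_(k < N - n) u k =
    \sum_(n < N.+1) F n * \sum_(k < N - n) u k.
  by rewrite big_ord_recr /= subnn big_ord0 mulr0 addr0.
rewrite -big_split; apply: eq_bigr => n _ /=.
have nN : (n <= N)%N by rewrite -ltnS.
by rewrite -mulrDr (subSn nN) big_ord_recr.
Qed.

(** Here [s] stands for the probability that some level is blocked. If [s < 1], the summed
    inequality bounds [(1 - s)] times each partial sum of [u] by [1 / (1 - r)], against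
    divergence. *)
Lemma renewal_recurrent (F u : nat -> R) r s : 0 <= r -> r < 1 ->
  (forall n, 0 <= F n) -> (forall n, 0 <= u n <= 1) ->
  (forall N, \sum_(n < N) F n <= s) ->
  (forall m, (1 - r ^+ m.+1) * u m <= \sum_(n < m.+1) F n * u (m - n)%N) ->
  (forall M, exists N, M <= \sum_(k < N) u k) -> 1 <= s.
Proof.
move=> r0 r1 F0 u01 Fs hu unb; rewrite leNgt; apply/negP => s1.
have main N : (1 - r) * ((1 - s) * \sum_(k < N) u k) <= 1.
  apply: le_trans (sum_geometric_le N r0 r1); rewrite ler_pM2l ?subr_gt0 //.
  have h1 : \sum_(m < N) (1 - r ^+ m.+1) * u m <= s * \sum_(k < N) u k.
    apply: (le_trans (ler_sum _ (fun (m : 'I_N) _ => hu m))); rewrite convolution_sum.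
    apply: (@le_trans _ _ (\sum_(n < N) F n * \sum_(k < N) u k)).
      apply: ler_sum => n _; apply: ler_wpM2l => //.
      rewrite -!(big_mkord xpredT) [leRHS](big_cat_nat (n := (N - n)%N)) ?leq_subr //=.
      by rewrite lerDl; apply: sumr_ge0 => k _; case/andP: (u01 k).
    rewrite -mulr_suml; apply: ler_wpM2r => //.
    by apply: sumr_ge0 => k _; case/andP: (u01 k).
  have h2 : \sum_(k < N) u k - \sum_(m < N) r ^+ m.+1 <= \sum_(m < N) (1 - r ^+ m.+1) * u m.
    rewrite -sumrB; apply: ler_sum => m _.
    have /andP[u0 u1] := u01 m; have : 0 <= r ^+ m.+1 by exact: exprn_ge0.
    nra.
  lra.
have c0 : 0 < (1 - r) * (1 - s) by apply: mulr_gt0; lra.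
have [N hN] := unb (2 / ((1 - r) * (1 - s))).
have := main N; rewrite mulrA; move: hN; rewrite ler_pdivrMr // mulrC; lra.
Qed.

End Pressure.

(** * Measurability and independence in the frog model *)

Section Model.
Context {R : realType} {d : measure_display} {T : measurableType d}.
Variables (P : probability T R) (p : R) (f : nat -> R).
Variables (eta : nat -> T -> nat) (xi : frog -> nat -> T -> bool).
Hypothesis p_gt : 1 / 2 < p.
Hypothesis p_lt1 : p < 1.
Hypothesis model : frog_model P p f eta xi.

Let X := frog_family eta xi.
Let steps w : frog -> nat -> bool := fun fr n => xi fr n w.

Lemma step_preimage fr n b :
  xi fr n @^-1` [set b] = X (inr (fr, n)) @^-1` [set nat_of_bool b].
Proof.
apply/seteqP; split=> w /=; first by move=> ->.
by case: (xi fr n w); case: b.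
Qed.

Lemma frog_family_measurable i x : measurable (X i @^-1` [set x]).
Proof.
case: model => meta mxi _ _ _; case: i => [j|[fr n]]; first exact: meta.
case: x => [|[|x]].
- by rewrite -(step_preimage fr n false).
- by rewrite -(step_preimage fr n true).
- rewrite (_ : _ @^-1` _ = set0) //; apply/seteqP; split=> w //=.
  by case: (xi fr n w).
Qed.

Lemma frog_independent J K A B : J `&` K = set0 ->
  generated X J A -> generated X K B -> P (A `&` B) = (P A * P B)%E.
Proof.
apply: generated_independent; first exact: frog_family_measurable.
by case: model.
Qed.

Lemma frog_generated_measurable J A : generated X J A -> measurable A.
Proof. by apply: generated_measurable; exact: frog_family_measurable. Qed.

(** * The law of a single walk *)

Definition step_prob (b : bool) : R := if b then p else 1 - p.

Lemma step_probN b : step_prob (~~ b) = 1 - step_prob b.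
Proof. by case: b => /=; rewrite ?subKr. Qed.

Lemma generated_step (J : set (nat + frog * nat)) fr n b : J (inr (fr, n)) ->
  generated X J (xi fr n @^-1` [set b]).
Proof. by move=> Jn; rewrite step_preimage; exact: generated_preimage. Qed.

Lemma probability_step fr n b : P (xi fr n @^-1` [set b]) = (step_prob b)%:E.
Proof.
case: model => _ mxi _ hp _; case: b; first exact: hp.
rewrite (_ : _ @^-1` _ = ~` (xi fr n @^-1` [set true])).
  by rewrite probability_setC // hp.
by apply/seteqP; split=> w /=; case: (xi fr n w).
Qed.

Definition steps_from fr s : set (nat + frog * nat) :=
  [set i | exists2 n, (s <= n)%N & i = inr (fr, n)].

(** The offset [s] serves the induction on [t]: after the step at time [s], the remaining event
    involves later steps only and is independent of it. *)
Definition reach_set b fr s t i : set T :=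
  [set w | reaches b (fun n => xi fr (s + n) w) t i].

Lemma reach_setn0 b fr s t : reach_set b fr s t 0 = setT.
Proof. by apply/seteqP; split=> // w _; case: t. Qed.

Lemma reach_set0S b fr s i : reach_set b fr s 0 i.+1 = set0.
Proof. by apply/seteqP; split. Qed.

Lemma reach_setSS b fr s t i : reach_set b fr s t.+1 i.+1 =
  (xi fr s @^-1` [set b] `&` reach_set b fr s.+1 t i) `|`
  (xi fr s @^-1` [set ~~ b] `&` reach_set b fr s.+1 t i.+2).
Proof.
have shift w : (fun n => xi fr (s + n) w) \o S = (fun n => xi fr (s.+1 + n) w).
  by apply/funext => n /=; rewrite addnS.
apply/seteqP; split=> w; rewrite /reach_set /= shift addn0.
  case: eqP => [->|/eqP h] hr; [by left|right; split=> //].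
  by move: h; case: (xi fr s w); case: (b).
by case=> -[-> hr]; rewrite ?eqxx // (_ : (~~ b == b) = false) //; case: (b).
Qed.

Lemma generated_reach_set b fr s t i :
  generated X (steps_from fr s) (reach_set b fr s t i).
Proof.
elim: t s i => [|t IH] s [|i].
- by rewrite reach_setn0; exact: generatedT.
- by rewrite reach_set0S; exact: generated0.
- by rewrite reach_setn0; exact: generatedT.
- rewrite reach_setSS.
  have sub : steps_from fr s.+1 `<=` steps_from fr s.
    by move=> _ [n sn ->]; exists n => //; exact: ltnW.
  by apply: generatedU; apply: generatedI; do ?[by apply: generated_step; exists s];
    exact: sub_generated sub _ _.
Qed.

Lemma probability_reach_set b fr s t i :
  P (reach_set b fr s t i) = (hit_prob (step_prob b) t i)%:E.
Proof.
elim: t s i => [|t IH] s [|i].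
- by rewrite reach_setn0 probability_setT.
- by rewrite reach_set0S measure0.
- by rewrite reach_setn0 probability_setT.
- have indep c k : P (xi fr s @^-1` [set c] `&` reach_set b fr s.+1 t k) =
      (step_prob c * hit_prob (step_prob b) t k)%:E.
    rewrite (@frog_independent [set inr (fr, s)] (steps_from fr s.+1)).
    + by rewrite probability_step IH.
    + by apply/seteqP; split=> // _ [-> [n sn [nE]]]; rewrite nE ltnn in sn.
    + exact: generated_step.
    + exact: generated_reach_set.
  have m c k : measurable (xi fr s @^-1` [set c] `&` reach_set b fr s.+1 t k).
    apply: measurableI; last exact: frog_generated_measurable (@generated_reach_set _ _ _ _ _).
    by apply: (@frog_generated_measurable setT); exact: generated_step.
  rewrite reach_setSS measureU //=; first by rewrite !indep step_probN.
  by apply/seteqP; split=> // w [[/= -> _] [/= h _]]; move: h; case: (b).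
Qed.

Let walk fr : set (nat + frog * nat) := [set i | exists n, i = inr (fr, n)].

Definition reach_ever b fr i : set T :=
  [set w | exists t, reaches b (steps w fr) t i].

Lemma reach_everE b fr i : reach_ever b fr i = \bigcup_t reach_set b fr 0 t i.
Proof. by apply/seteqP; split=> w; [case=> t h; exists t|case=> t _ h; exists t]. Qed.

Lemma generated_reach_ever b fr i : generated X (walk fr) (reach_ever b fr i).
Proof.
rewrite reach_everE; apply: generated_bigcup => t.
apply: sub_generated (@generated_reach_set b fr 0 t i).
by move=> _ [n _ ->]; exists n.
Qed.

Lemma probability_reach_ever b fr i :
  P (reach_ever b fr i) = (ruin_prob (step_prob b) i)%:E.
Proof.
have m t : measurable (reach_set b fr 0 t i).
  exact: frog_generated_measurable (@generated_reach_set _ _ _ _ _).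
have h : P (reach_set b fr 0 t i) @[t --> \oo] --> P (reach_ever b fr i).
  rewrite reach_everE; apply: nondecreasing_cvg_mu => //.
    exact: bigcupT_measurable.
  move=> t t' tt'; apply/subsetPset => w; exact: reaches_nondecreasing.
rewrite -(cvg_lim _ h) //; apply/cvg_lim => //.
under eq_fun do rewrite probability_reach_set.
apply: cvg_EFin; first by near=> t.
apply: hit_prob_cvg.
- by case: b {m h}; rewrite /step_prob; have := p_gt; have := p_lt1; lra.
- by case: b {m h}; rewrite /step_prob; have := p_gt; have := p_lt1; lra.
Unshelve. all: by end_near. Qed.

Let rho := (1 - p) / p.

Lemma probability_rises fr i :
  P [set w | rises (steps w) fr i] = (rho ^+ i)%:E.
Proof.
have := probability_reach_ever false fr i; rewrite /reach_ever /rises => ->.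
move: p_gt p_lt1 => ? ?.
rewrite ruin_prob_transient /= ?/step_prob; [|lra..].
by rewrite subKr.
Qed.

Lemma probability_falls fr i : P [set w | falls (steps w) fr i] = 1%E.
Proof.
have := probability_reach_ever true fr i; rewrite /reach_ever /falls => ->.
by move: p_gt p_lt1 => ? ?; rewrite ruin_prob_recurrent //= /step_prob; lra.
Qed.

Lemma generated_rises fr i : generated X (walk fr) [set w | rises (steps w) fr i].
Proof. exact: generated_reach_ever. Qed.

(** * Poisson thinning at one site and along a row of sites *)

Definition calm j i K : set T :=
  [set w | forall k, (k < K)%N -> ~ rises (steps w) (Some (j, k)) i].

Let walks_below j K : set (nat + frog * nat) :=
  [set i | exists2 k, (k < K)%N & exists n, i = inr (Some (j, k), n)].

Lemma calmS j i K :
  calm j i K.+1 = calm j i K `&` ~` [set w | rises (steps w) (Some (j, K)) i].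
Proof.
apply/seteqP; split=> w.
  by move=> h; split=> [k kK|]; apply: h => //; exact: ltnW.
by move=> [h h'] k; rewrite ltnS leq_eqVlt => /orP[/eqP ->|/h].
Qed.

Lemma generated_calm j i K : generated X (walks_below j K) (calm j i K).
Proof.
elim: K => [|K IH].
  by rewrite (_ : calm _ _ _ = setT); [exact: generatedT|apply/seteqP; split].
rewrite calmS; apply: generatedI.
  by apply: sub_generated IH => _ [k kK [n ->]]; exists k; [exact: ltnW|exists n].
apply: generatedC; apply: sub_generated (@generated_rises _ i).
by move=> _ [n ->]; exists K => //; exists n.
Qed.

Lemma probability_calm j i K : P (calm j i K) = ((1 - rho ^+ i) ^+ K)%:E.
Proof.
elim: K => [|K IH].
  by rewrite (_ : calm _ _ _ = setT) ?probability_setT //; apply/seteqP; split.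
rewrite calmS (@frog_independent (walks_below j K) (walk (Some (j, K)))).
- rewrite IH probability_setC; last exact: frog_generated_measurable (@generated_rises _ _).
  by rewrite probability_rises exprSr.
- by apply/seteqP; split=> // _ [[k kK [n ->]] [n' [kE _]]]; rewrite kE ltnn in kK.
- exact: generated_calm.
- by apply: generatedC; exact: generated_rises.
Qed.

Definition quiet j i : set T :=
  [set w | forall k, (k < eta j w)%N -> ~ rises (steps w) (Some (j, k)) i].

Let site_vars (S : set nat) : set (nat + frog * nat) :=
  [set i | match i with
           | inl j => S j
           | inr (Some (j, _), _) => S j
           | inr (None, _) => False
           end].

Lemma quietE j i : quiet j i = \bigcup_K (eta j @^-1` [set K] `&` calm j i K).
Proof.
apply/seteqP; split=> w; first by move=> h; exists (eta j w).
by move=> [K _ [<-]].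
Qed.

Lemma generated_quiet (S : set nat) j i : S j -> generated X (site_vars S) (quiet j i).
Proof.
move=> Sj; rewrite quietE; apply: generated_bigcup => K; apply: generatedI.
  by apply: (@generated_preimage _ _ X _ (inl j)).
apply: sub_generated (@generated_calm j i K).
by move=> _ [k kK [n ->]].
Qed.

(** Splitting by [eta j = K] gives [expR (- f j)] times the exponential series at
    [f j * (1 - rho ^+ i)]. *)
Lemma probability_quiet j i : (0 < j)%N -> P (quiet j i) = (expR (- (f j * rho ^+ i)))%:E.
Proof.
move=> j0; have [meta _ hf _ _] := model.
have indep K : P (eta j @^-1` [set K] `&` calm j i K) =
    (expR (- f j) * exp_coeff (f j * (1 - rho ^+ i)) K)%:E.
  rewrite (@frog_independent [set inl j] (walks_below j K)).
  - rewrite hf // probability_calm -EFinM /exp_coeff /=; congr (_%:E).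
    by move: (1 - _) => c; rewrite exprMn; ring.
  - by apply/seteqP; split=> // _ [-> [k kK [n]]].
  - by apply: (@generated_preimage _ _ X _ (inl j)).
  - exact: generated_calm.
have m K : measurable (eta j @^-1` [set K] `&` calm j i K).
  by apply: measurableI => //; exact: frog_generated_measurable (@generated_calm _ _ _).
have h : (fun n => \sum_(0 <= K < n) P (eta j @^-1` [set K] `&` calm j i K))%E @ \oo -->
    P (quiet j i).
  rewrite quietE; apply: measure_semi_sigma_additive => //.
    apply: trivIset_setIr; apply/trivIsetP => K K' _ _ /eqP KK'.
    by apply/seteqP; split=> // w [/= -> /KK'].
  exact: bigcupT_measurable.
rewrite -(cvg_lim _ h) //; apply/cvg_lim => //.
under eq_fun do (under eq_bigr do rewrite indep; rewrite sumEFin -mulr_sumr).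
apply: cvg_EFin; first by near=> t.
rewrite (_ : - (f j * _) = - f j + f j * (1 - rho ^+ i)); last by ring.
rewrite expRD; apply: cvgMr.
exact: is_cvg_series_exp_coeff.
Unshelve. all: by end_near. Qed.

(** The level [L] stays fixed while the row grows in inductions on [k]; it is later taken to be
    [(n + k).+1]. *)
Definition quiet_row n k L : set T :=
  [set w | forall j, (n < j <= n + k)%N -> quiet j (L - j) w].

Lemma quiet_row0 n L : quiet_row n 0 L = setT.
Proof. by apply/seteqP; split=> // w _ j; lia. Qed.

Lemma quiet_rowS n k L :
  quiet_row n k.+1 L = quiet_row n k L `&` quiet (n + k).+1 (L - (n + k).+1).
Proof.
apply/seteqP; split=> w.
  by move=> h; split=> [j jk|]; apply: h; lia.
move=> [h h'] j jk; have [->//|jk'] := eqVneq j (n + k).+1.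
by apply: h; lia.
Qed.

Lemma generated_quiet_row n k L :
  generated X (site_vars [set j | (n < j <= n + k)%N]) (quiet_row n k L).
Proof.
elim: k => [|k IH]; first by rewrite quiet_row0; exact: generatedT.
rewrite quiet_rowS; apply: generatedI.
  by apply: sub_generated IH => -[j|[[[j m]|] s]] //=; lia.
by apply: generated_quiet; rewrite /=; lia.
Qed.

Lemma probability_quiet_row n k L : P (quiet_row n k L) =
  (expR (- \sum_(i < k) f (n + i).+1 * rho ^+ (L - (n + i).+1)))%:E.
Proof.
elim: k => [|k IH].
  by rewrite quiet_row0 probability_setT big_ord0 oppr0 expR0.
rewrite quiet_rowS (@frog_independent (site_vars [set j | (n < j <= n + k)%N])
  (site_vars [set (n + k).+1])).
- by rewrite IH probability_quiet // big_ord_recr /= opprD expRD.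
- by apply/seteqP; split=> // -[j|[[[j m]|] s]] //= []; lia.
- exact: generated_quiet_row.
- exact: generated_quiet.
Qed.

Let rho_ge0 : 0 <= rho.
Proof. by move: p_gt p_lt1 => ? ?; rewrite /rho divr_ge0; lra. Qed.

Let rho_lt1 : rho < 1.
Proof. by move: p_gt p_lt1 => ? ?; rewrite /rho ltr_pdivrMr; lra. Qed.

Lemma probability_quiet_pressure n k :
  P (quiet_row n k (n + k).+1) = (expR (- pressure rho f n k))%:E.
Proof.
rewrite probability_quiet_row; congr ((expR (- _))%:E); apply: eq_bigr => i _.
by congr (_ * _ ^+ _); lia.
Qed.

(** * Blocked levels and the first of them *)

Definition block_set m : set T := [set w | blocked (eta ^~ w) (steps w) m].

Lemma block_setE m : block_set m =
  ~` [set w | rises (steps w) None m.+1] `&` quiet_row 0 m m.+1.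
Proof.
apply/seteqP; split=> w [hN h]; split=> //.
- by move=> j jm k kj; apply: h.
- by move=> j k jm kj; apply: (h j).
Qed.

Let vars_upto m : set (nat + frog * nat) := walk None `|` site_vars [set j | (j <= m)%N].

Lemma generated_block_set m n : (m <= n)%N -> generated X (vars_upto n) (block_set m).
Proof.
move=> mn; rewrite block_setE; apply: generatedI.
  by apply: generatedC; apply: sub_generated (@generated_rises None m.+1); left.
apply: sub_generated (@generated_quiet_row 0 m m.+1).
by move=> i hi; right; move: i hi => -[j|[[[j k]|] s]] //=; lia.
Qed.

Lemma block_set_measurable m : measurable (block_set m).
Proof. exact: frog_generated_measurable (generated_block_set (leqnn m)). Qed.

Lemma probability_block_set m :
  P (block_set m) = ((1 - rho ^+ m.+1) * expR (- pressure rho f 0 m))%:E.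
Proof.
rewrite block_setE (@frog_independent (walk None) (site_vars [set j | (0 < j <= m)%N])).
- rewrite probability_setC; last exact: frog_generated_measurable (@generated_rises _ _).
  by rewrite probability_rises -{2}(add0n m) probability_quiet_pressure.
- by apply/seteqP; split=> // _ [[s ->]].
- by apply: generatedC; exact: generated_rises.
- exact: (@generated_quiet_row 0 m m.+1).
Qed.

(** [seqDU] removes the earlier blocked levels, so these events are disjoint while still depending
    only on the initial frog and the sites up to [n]. *)
Definition first_block n : set T := seqDU block_set n.

Lemma generated_first_block n : generated X (vars_upto n) (first_block n).
Proof.
apply: generatedD; first exact: generated_block_set.
rewrite -bigcup_mkord bigcup_mkcond; apply: generated_bigcup => k.
by case: ifPn => [/set_mem/= kn|_]; [apply: generated_block_set; exact: ltnW|exact: generated0].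
Qed.

Lemma first_block_measurable n : measurable (first_block n).
Proof. exact: frog_generated_measurable (@generated_first_block n). Qed.

(* Once the frogs from [0, n] fail to reach [n + 1], they do not reach [m + 1] either. *)
Lemma first_blockI n m : (n <= m)%N ->
  first_block n `&` block_set m = first_block n `&` quiet_row n (m - n) m.+1.
Proof.
move=> nm; apply/seteqP; split=> w [hn hm]; split=> //.
  by move=> j jm k kj; case: hm => _; apply => //; lia.
case: hn => -[hN hS] _; split=> [h|j k jm kj]; first by apply: hN; apply: rises_le h; lia.
have [jn|nj] := leqP j n; last by apply: (hm j) => //; lia.
by move=> h; apply: (hS j k) => //; [lia|apply: rises_le h; lia].
Qed.

(** Regeneration: the first block at [n] and the row of sites beyond [n] involve disjoint sets of
    variables. *)
Lemma probability_first_blockI n m : (n <= m)%N ->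
  P (first_block n `&` block_set m) =
  (P (first_block n) * (expR (- pressure rho f n (m - n)))%:E)%E.
Proof.
move=> nm; rewrite first_blockI //.
rewrite (@frog_independent (vars_upto n) (site_vars [set j | (n < j <= n + (m - n))%N])).
- by rewrite -{2}(subnKC nm) probability_quiet_pressure.
- by apply/seteqP; split=> // -[j|[[[j k]|] s]] [[[? []]|/=]] //=; lia.
- exact: generated_first_block.
- exact: generated_quiet_row.
Qed.

(** * Divergent series: some level is almost surely blocked *)

Hypothesis f_ge0 : forall j, (0 < j)%N -> 0 <= f j.
Hypothesis f_mono : forall i j, (0 < i)%N -> (i <= j)%N -> f i <= f j.

Let first_prob n : R := fine (P (first_block n)).

Let first_probE n : P (first_block n) = (first_prob n)%:E.
Proof. by rewrite /first_prob fineK // fin_num_measure //; exact: first_block_measurable. Qed.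

Lemma block_set_renewal m : (1 - rho ^+ m.+1) * expR (- pressure rho f 0 m) <=
  \sum_(n < m.+1) first_prob n * expR (- pressure rho f 0 (m - n)%N).
Proof.
rewrite -lee_fin -probability_block_set.
have -> : block_set m = \big[setU/set0]_(n < m.+1) (first_block n `&` block_set m).
  rewrite -big_distrl /= -bigsetU_seqDU setIidr //.
  by rewrite (bigD1 ord_max) //=; left.
rewrite (@measure_bigsetU _ _ _ P (fun n => first_block n `&` block_set m)); first last.
- by apply: trivIset_setIr; exact: trivIset_seqDU.
- by move=> n; apply: measurableI; [exact: first_block_measurable|exact: block_set_measurable].
rewrite -sumEFin; apply: lee_sum => n _ /=.
have nm : (n <= m)%N by rewrite -ltnS.
rewrite (probability_first_blockI nm) first_probE -EFinM lee_fin.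
apply: ler_wpM2l; first exact: fine_ge0.
(* Monotonicity of [f] lets the row after [n] be replaced by one starting at the origin. *)
by rewrite ler_expR lerN2; exact: pressure_shift.
Qed.

Lemma sum_first_prob_le N : \sum_(n < N) first_prob n <= fine (P (\bigcup_m block_set m)).
Proof.
have mU : measurable (\bigcup_m block_set m).
  by apply: bigcupT_measurable => m; exact: block_set_measurable.
rewrite -lee_fin -sumEFin fineK ?fin_num_measure //.
under eq_bigr do rewrite -first_probE.
rewrite -(@measure_bigsetU _ _ _ P first_block).
- apply: le_measure; rewrite ?inE //.
    by apply: bigsetU_measurable => n _; exact: first_block_measurable.
  by rewrite -bigcup_mkord => w [n _ [hn _]]; exists n.
- exact: first_block_measurable.
- exact: trivIset_seqDU.
Qed.

Let c := rho / (1 - rho).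

Lemma divergent_transient :
  (forall M, exists N, M <= \sum_(k < N) expR (- (c * f k.+1))) ->
  transient P eta xi.
Proof.
move=> unb.
have mU : measurable (\bigcup_m block_set m).
  by apply: bigcupT_measurable => m; exact: block_set_measurable.
have P1 : P (\bigcup_m block_set m) = 1%E.
  apply/eqP; rewrite eq_le probability_le1 //= -[leRHS]fineK ?fin_num_measure // lee_fin.
  apply: (renewal_recurrent rho_ge0 rho_lt1 _ _ sum_first_prob_le block_set_renewal).
  - by move=> n; exact: fine_ge0.
  - move=> n; rewrite expR_ge0 /= -[leRHS]expR0 ler_expR oppr_le0.
    by apply: sumr_ge0 => i _; rewrite mulr_ge0 ?f_ge0 // exprn_ge0.
  - move=> M; have [N hN] := unb M; exists N.+1; apply: le_trans hN _.
    (* The term [k = 0] is dropped, since [pressure_le] compares index [k + 1] with [f (k + 1)]. *)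
    rewrite big_ord_recl; apply: (@le_trans _ _ (\sum_(k < N) expR (- pressure rho f 0 k.+1))).
      by apply: ler_sum => k _; rewrite ler_expR lerN2; exact: pressure_le.
    by rewrite lerDr expR_ge0.
exists (~` \bigcup_m block_set m); split; first exact: measurableC.
  by rewrite probability_setC // P1 subee.
move=> w inf [m _ /blocked_finite fin]; apply: inf; apply: sub_finite_set fin.
by move=> jk [].
Qed.

(** * Convergent series: a head start past the levels likely to block *)

Definition head_start N : set T := [set w | forall n, (n < N)%N -> xi None n w = false].

Lemma head_startS N : head_start N.+1 = head_start N `&` xi None N @^-1` [set false].
Proof.
apply/seteqP; split=> w.
  by move=> h; split=> [n nN|]; apply: h => //; exact: ltnW.
by move=> [h h'] n; rewrite ltnS leq_eqVlt => /orP[/eqP ->|/h].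
Qed.

Let first_steps N : set (nat + frog * nat) :=
  [set i | exists2 n, (n < N)%N & i = inr (None, n)].

Lemma generated_head_start N : generated X (first_steps N) (head_start N).
Proof.
elim: N => [|N IH].
  by rewrite (_ : head_start 0 = setT); [exact: generatedT|apply/seteqP; split].
rewrite head_startS; apply: generatedI.
  by apply: sub_generated IH => _ [n nN ->]; exists n => //; exact: ltnW.
by apply: generated_step; exists N.
Qed.

Lemma probability_head_start N : P (head_start N) = ((1 - p) ^+ N)%:E.
Proof.
elim: N => [|N IH].
  by rewrite (_ : head_start 0 = setT) ?probability_setT //; apply/seteqP; split.
rewrite head_startS (@frog_independent (first_steps N) [set inr (None, N)]).
- by rewrite IH probability_step exprSr.
- by apply/seteqP; split=> // _ [[n nN ->] [nE]]; rewrite nE ltnn in nN.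
- exact: generated_head_start.
- exact: generated_step.
Qed.

Lemma negligible_unbounded fr :
  P.-negligible [set w | forall i, rises (steps w) fr i].
Proof.
have m i : measurable [set w | rises (steps w) fr i].
  exact: frog_generated_measurable (@generated_rises _ _).
have -> : [set w | forall i, rises (steps w) fr i] =
    \bigcap_i [set w | rises (steps w) fr i].
  by apply/seteqP; split=> w h i; [move=> _; exact: h|exact: h].
apply/negligibleP; first exact: bigcapT_measurable.
apply/eqP; rewrite -measure_le0.
have rcv : (rho ^+ n)%:E @[n --> \oo] --> (0 : R)%:E.
  apply: cvg_EFin; first by near=> n.
  by apply: cvg_expr; rewrite ger0_norm.
apply: (@le_trans _ _ (limn (fun n => (rho ^+ n)%:E))); last by rewrite (cvg_lim _ rcv).
apply: lime_ge; first by apply/cvg_ex; eexists; exact: rcv.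
near=> n; rewrite -(probability_rises fr); apply: le_measure; rewrite ?inE //.
  exact: bigcapT_measurable.
by move=> w; apply.
Unshelve. all: by end_near. Qed.

Lemma negligible_never_falls fr i : P.-negligible [set w | ~ falls (steps w) fr i].
Proof.
have m : measurable [set w | falls (steps w) fr i].
  exact: frog_generated_measurable (@generated_reach_ever true fr i).
exists (~` [set w | falls (steps w) fr i]); split=> //; first exact: measurableC.
by rewrite probability_setC // probability_falls subee.
Qed.

(** Outside this null set every walk is bounded above and every frog that starts at a site [j] falls
    by [j], as [unblocked_infinite] requires. *)
Definition odd_walk : set T := \bigcup_j \bigcup_k
  ([set w | forall i, rises (steps w) (Some (j, k)) i] `|`
   [set w | ~ falls (steps w) (Some (j, k)) j]).

Lemma negligible_odd_walk : P.-negligible odd_walk.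
Proof.
apply: negligible_bigcup => j; apply: negligible_bigcup => k.
by apply: negligibleU; [exact: negligible_unbounded|exact: negligible_never_falls].
Qed.

Lemma unblocked_sub N :
  head_start N `\` \bigcup_k (head_start N `&` quiet_row 0 (N + k) (N + k).+1) `<=`
  inf_many_hit eta xi `|` odd_walk.
Proof.
move=> w [hN nb]; have [|no] := pselect (odd_walk w); [by right|left].
apply: (@unblocked_infinite _ _ _ _ N) => //.
- move=> [j k]; apply: contrapT => h; apply: no; exists j => //; exists k => //; left.
  by move=> i; apply: contrapT => hi; apply: h; exists i.
- move=> [j k]; apply: falls_hits_origin; apply: contrapT => h; apply: no.
  by exists j => //; exists k => //; right.
- move=> n Nn; apply: contrapT => h; apply: nb; exists (n - N)%N => //; split=> //.
  rewrite subnKC // => j jn k kj hr; apply: h; exists j, k.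
  by rewrite add0n in jn.
Qed.

Lemma summable_not_transient (M : R) :
  (forall N, \sum_(k < N) expR (- (c * f k.+1)) <= M) -> ~ transient P eta xi.
Proof.
move=> bnd tr.
pose u k := expR (- pressure rho f 0 k).
have ubnd N : series u N <= (1 + (1 - rho) * M) / (1 - rho).
  rewrite ler_pdivlMr ?subr_gt0 // mulrC /series /= big_mkord.
  apply: (@le_trans _ _ ((1 - rho) * \sum_(k < N.+1) u k)).
    by apply: ler_wpM2l; [rewrite subr_ge0 ltW|rewrite big_ord_recr /= lerDl expR_ge0].
  apply: le_trans (sum_expR_pressure f N rho_ge0 rho_lt1) _.
  by rewrite lerD2l; apply: ler_wpM2l => //; rewrite subr_ge0 ltW.
have umono : nondecreasing_seq (series u).
  by apply/nondecreasing_seqP => n; rewrite !seriesEnat /= big_nat_recr //= lerDl expR_ge0.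
have ucv : cvgn (series u).
  by apply: nondecreasing_is_cvgn => //; exists ((1 + (1 - rho) * M) / (1 - rho)) => _ [n _ <-].
(* Past [N] the tail of the convergent series of [u] is at most one half. *)
have [N hN] : exists N, forall n, series u (N + n)%N - series u N <= 1 / 2.
  have := ucv => /cvgrPdist_le/(_ (1 / 2)) /(_ ltac:(lra)) [N _ hN].
  exists N => n; have := hN N (leqnn N); rewrite /= ler_norml => /andP[_ h].
  have := nondecreasing_cvgn_le umono ucv (N + n)%N; lra.
pose bad k := head_start N `&` quiet_row 0 (N + k) (N + k).+1.
have Pbad k : P (bad k) = ((1 - p) ^+ N * u (N + k)%N)%:E.
  rewrite (@frog_independent (first_steps N) (site_vars [set j | (0 < j <= 0 + (N + k))%N])).
  - by rewrite probability_head_start -{2}(add0n (N + k)%N) probability_quiet_pressure.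
  - by apply/seteqP; split=> // _ [[n _ ->]].
  - exact: generated_head_start.
  - exact: (@generated_quiet_row 0 (N + k) (N + k).+1).
have mH : measurable (head_start N).
  exact: frog_generated_measurable (@generated_head_start N).
have mbad k : measurable (bad k).
  apply: measurableI => //.
  exact: frog_generated_measurable (@generated_quiet_row 0 (N + k) (N + k).+1).
have mU : measurable (\bigcup_k bad k) by exact: bigcupT_measurable.
have pN : 0 < (1 - p) ^+ N by rewrite exprn_gt0 // subr_gt0.
(* By independence and the tail bound, blocking past [N] spoils at most half of the head start. *)
have PU : (P (\bigcup_k bad k) <= ((1 - p) ^+ N * (1 / 2))%:E)%E.
  apply: (@le_trans _ _ (\sum_(0 <= k <oo) P (bad k))%E).
    exact: measure_sigma_subadditive.
  apply: lime_le; first by apply: is_cvg_nneseries.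
  near=> n; rewrite (eq_bigr (fun k => ((1 - p) ^+ N * u (N + k)%N)%:E)) //.
  rewrite sumEFin lee_fin -mulr_sumr ler_pM2l //.
  apply: le_trans (hN n); rewrite le_eqVlt; apply/orP; left; apply/eqP.
  rewrite !seriesEnat /= (@big_cat_nat _ _ _ N 0 (N + n)) ?leq_addr //= addrAC subrr add0r.
  have := @big_addn _ 0 +%R 0 (N + n) N xpredT u; rewrite add0n addKn => ->.
  by apply: eq_bigr => k _; rewrite addnC.
have [Z [mZ PZ ZE]] := negligibleU tr negligible_odd_walk.
(* Under transience the head start is covered by a null set and the bad events, although these have
   at most half its positive probability. *)
have : (P (head_start N) <= P (Z `|` \bigcup_k bad k))%E.
  apply: le_measure; rewrite ?inE //; first exact: measurableU.
  move=> w hw; have [hb|hb] := pselect ((\bigcup_k bad k) w); [by right|left].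
  by apply: ZE; apply: (@unblocked_sub N); split.
apply/negP; rewrite -ltNge.
apply: le_lt_trans (measureU2 _ mZ mU) _; rewrite PZ add0e.
apply: le_lt_trans PU _; rewrite probability_head_start lte_fin.
by move: ((1 - p) ^+ N) pN => x; lra.
Unshelve. all: by end_near. Qed.

End Model.

(** * Divergence as unbounded partial sums, and the equivalence *)

Lemma nneseries_unbounded {R : realType} (u : nat -> R) : (forall n, 0 <= u n) ->
  (\sum_(1 <= j <oo) (u j)%:E)%E = +oo%E <->
  forall M, exists N, M <= \sum_(k < N) u k.+1.
Proof.
move=> u0.
have partial N : (\sum_(1 <= j < N.+1) (u j)%:E)%E = (\sum_(k < N) u k.+1)%:E.
  by rewrite sumEFin big_add1 big_mkord.
have u0' n : (1 <= n)%N -> xpredT n -> (0 <= (u n)%:E)%E by rewrite lee_fin.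
split=> [soo M|unb].
  apply: contrapT => /forallNP h.
  have : (\sum_(1 <= j <oo) (u j)%:E <= M%:E)%E.
    apply: lime_le; first exact: is_cvg_nneseries.
    apply: nearW => -[|n].
      (* At index 0 the sum is empty; [h] at [N = 0] gives [0 < M]. *)
      by rewrite big_geq // lee_fin; have /negP := h 0%N; rewrite big_ord0 -ltNge => /ltW.
    by rewrite partial lee_fin ltW // ltNge; exact/negP.
  by rewrite soo leye_eq.
apply/eqyP => M M0; have [N hN] := unb M.
apply: le_trans (nneseries_lim_ge N.+1 u0').
by rewrite partial lee_fin.
Qed.

Theorem theorem2 (R : realType) (d : measure_display) (T : measurableType d)
    (P : probability T R) (p : R) (f : nat -> R)
    (eta : nat -> T -> nat) (xi : frog -> nat -> T -> bool) :
  1 / 2 < p < 1 ->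
  (forall j, (0 < j)%N -> 0 <= f j) ->
  (forall i j, (0 < i)%N -> (i <= j)%N -> f i <= f j) ->
  frog_model P p f eta xi ->
  (transient P eta xi <->
   (\sum_(1 <= j <oo) (expR (- ((1 - p) / (2 * p - 1) * f j)))%:E)%E = +oo%E).
Proof.
move=> /andP[p_gt p_lt1] f_ge0 f_mono model.
(* The constant of the series is [rho / (1 - rho)] with [rho = (1 - p) / p]. *)
have cE : (1 - p) / (2 * p - 1) = (1 - p) / p / (1 - (1 - p) / p).
  by field; apply/andP; split; lra.
rewrite nneseries_unbounded; last by move=> n; exact: expR_ge0.
split=> [tr|unb]; last first.
  by apply: (divergent_transient p_gt p_lt1 model) => //; rewrite -cE.
move=> M; apply: contrapT => /forallNP h.
apply: (summable_not_transient p_gt p_lt1 model (M := M)) tr => // N.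
by rewrite -cE ltW // ltNge; exact/negP.
Qed.
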